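(* Let $X$ and $Y$ be complex $n\times n$ matrices and let $p\ge1$ be real. Then $$\|\,[X,Y]\,\|_2\le\sqrt2\,\|X\|_2\,\|Y\|_{(2),2}\le 2^{\max(1/2,\,1-1/p)}\,\|X\|_2\,\|Y\|_p.$$
   Context: $[X,Y]=XY-YX$ is the commutator. With $\sigma_1(Y)\ge\sigma_2(Y)\ge\dots\ge\sigma_n(Y)\ge0$ the singular values of $Y$ (and $\sigma_k(Y)=0$ for $k>n$), $\|Y\|_p=(\sum_i\sigma_i(Y)^p)^{1/p}$ is the Schatten $p$-norm ($\|\cdot\|_2$ being the Frobenius norm) and $\|Y\|_{(2),2}=\big(\sigma_1(Y)^2+\sigma_2(Y)^2\big)^{1/2}$ (the Ky Fan $(p,k)$-norm with $p=k=2$). *)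

(* Defs.v *)
From mathcomp Require Import all_boot all_order all_algebra.
From mathcomp Require Import complex.
From mathcomp Require Import reals exp.

Set Implicit Arguments.
Unset Strict Implicit.
Unset Printing Implicit Defensive.

Import Order.TTheory GRing.Theory Num.Theory.

Local Open Scope ring_scope.
Local Open Scope sesquilinear_scope.

Definition commutator (K : pzRingType) (n : nat) (X Y : 'M[K]_n) : 'M[K]_n :=
  X *m Y - Y *m X.

(* The singular values are the square roots of the eigenvalues of Y^* Y, with
   multiplicity, in nonincreasing order.  Since Y^* Y is positive semidefinite,
   the entries of spectral_diag are its eigenvalues and they are nonnegative
   reals; complex.Re only changes their type.  The sequence is indexed from 0,
   so (singular_values Y)`_k is sigma_(k+1)(Y), and it is 0 when n <= k. *)
Definition singular_values (R : realType) (n : nat) (Y : 'M[R[i]]_n) : seq R :=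
  sort >=%R [seq Num.sqrt (complex.Re (spectral_diag (Y^t* *m Y) 0 i))
            | i <- enum 'I_n].

Definition schatten_norm (R : realType) (p : R) (n : nat) (Y : 'M[R[i]]_n) : R :=
  (\sum_(s <- singular_values Y) s `^ p) `^ p^-1.

Definition ky_fan22_norm (R : realType) (n : nat) (Y : 'M[R[i]]_n) : R :=
  Num.sqrt ((singular_values Y)`_0 ^+ 2 + (singular_values Y)`_1 ^+ 2).

(* Main.v *)
Require Import Defs.
From mathcomp Require Import all_boot all_order all_algebra.
From mathcomp Require Import complex.
From mathcomp Require Import reals exp hoelder.
From mathcomp Require Import ring lra.

(** Write K for sigma_1(Y)^2 + sigma_2(Y)^2 and |.| for the Frobenius norm.
    The commutator, hence the left-hand side, does not change when Y is
    replaced by Z = Y - c I; choose c so that tr Z (X X^* + X^* X) = 0.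

    Expanding the squares, the cross terms of X Z - Z X and of Z X^* + X^* Z
    cancel, which gives
      |X Z - Z X|^2 + |Z X^* + X^* Z|^2
        = tr (X X^* + X^* X) (Z Z^* + Z^* Z),
    and so bounds |[X, Y]|^2 by the right-hand side
    ([frobenius_sq_commutator_le]).  Up to normalisation this is a variance of
    Y in the mixed state D = X X^* + X^* X, and the key point is that D can be
    decomposed into pure states without changing the mean: since tr D Z = 0,
    there are vectors u with D = sum_u u^* u and <u Z, u> = 0 for every u.
    This form of the convexity of the numerical range is
    [isotropic_rearrangement]; it is proved by rotating two vectors of a
    decomposition into each other until one of them is isotropic.

    For a unit vector u with <u Z, u> = 0, let f be the direction of u Z, or 0
    if u Z = 0.  Then |u Z| <= |f Y^*| and |u Z^*| <= |u Y^*|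
    ([qform_sub_scalar_le]).  As u and f are orthogonal, the variational
    principle for the two largest eigenvalues of Y^* Y ([ky_fan_pair]) gives
    |u Z|^2 + |u Z^*|^2 <= K.  Summing over the decomposition,
    |[X, Y]|^2 <= K tr D = 2 K |X|^2.

    The second inequality only concerns sigma_1 and sigma_2.  It compares the
    l^2 and l^p norms on R^2: the l^2 norm is the smaller one when p <= 2, and
    Hoelder's inequality against (1, 1) costs a factor 2^(1/2 - 1/p) when
    p > 2. *)

Set Implicit Arguments.
Unset Strict Implicit.
Unset Printing Implicit Defensive.
Import Order.TTheory GRing.Theory Num.Theory.
Local Open Scope ring_scope.
Local Open Scope sesquilinear_scope.

Local Notation "''[' u , v ]" := (dotmx u v) : ring_scope.
Local Notation "''[' u ]" := (dotmx u u) : ring_scope.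

(** * Quadratic forms and their isotropic decompositions *)

Section QuadraticForms.
Variables (C : numClosedFieldType) (n : nat).
Implicit Types (M A B : 'M[C]_n) (u v x y : 'rV[C]_n) (s : seq 'rV[C]_n).

(** Vectors are rows, so that [u *m M] is the image of [u] under [M]. *)
Definition qform M u := '[u *m M, u].

Lemma dotmxC u v : '[u, v] = ('[v, u])^*.
Proof. by rewrite (hermC (@dotmx C n)) expr0 mul1r. Qed.

Lemma dotmxZl a u v : '[a *: u, v] = a * '[u, v].
Proof. by rewrite !dotmxE -scalemxAl mxE. Qed.

Lemma dotmxZr a u v : '[u, a *: v] = a^* * '[u, v].
Proof. by rewrite dotmxC dotmxZl rmorphM /= -dotmxC. Qed.

Lemma dotmxDl u v x : '[u + v, x] = '[u, x] + '[v, x].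
Proof. by rewrite !dotmxE mulmxDl mxE. Qed.

Lemma dotmxDr x u v : '[x, u + v] = '[x, u] + '[x, v].
Proof. by rewrite dotmxC dotmxDl rmorphD /= -!dotmxC. Qed.

Lemma dotmx_adj M u v : '[u *m M, v] = '[u, v *m M^t*].
Proof. by rewrite !dotmxE trmx_mul map_mxM trmxCK mulmxA. Qed.

Lemma qformZ M a u : qform M (a *: u) = `|a| ^+ 2 * qform M u.
Proof. by rewrite /qform -scalemxAl dotmxZl dotmxZr mulrA normCK. Qed.

Lemma qform_lin M a u v : qform M (u + a *: v) =
  qform M u + a^* * '[u *m M, v] + a * '[v *m M, u] + `|a| ^+ 2 * qform M v.
Proof.
rewrite -qformZ /qform mulmxDl dotmxDl !dotmxDr -scalemxAl.
by rewrite !dotmxZl !dotmxZr !addrA.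
Qed.

Lemma qformD M B u : qform (M + B) u = qform M u + qform B u.
Proof. by rewrite /qform mulmxDr dotmxDl. Qed.

Lemma qformZl M a u : qform (a *: M) u = a * qform M u.
Proof. by rewrite /qform -scalemxAr dotmxZl. Qed.

Lemma qform_adj M u : qform (M^t*) u = (qform M u)^*.
Proof. by rewrite /qform dotmx_adj trmxCK dotmxC. Qed.

Lemma qform_herm_real A u : A^t* = A -> qform A u \is Num.real.
Proof. by move=> hA; apply/CrealP; rewrite -qform_adj hA. Qed.

(** A phase making the cross term of a Hermitian form purely imaginary: it
    frees the real parameter of the rotation for another purpose. *)
Lemma exists_phase (h : C) : exists2 e : C, `|e| = 1 & e^* * h + e * h^* = 0.
Proof.
have [->|h0] := eqVneq h 0.
  by exists 1; rewrite ?normr1// rmorph0 !mulr0 addr0.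
have nh0 : `|h| != 0 by rewrite normr_eq0.
exists ('i * (h / `|h|)).
  by rewrite normrM normCi mul1r normrM normfV normr_id divff.
rewrite !rmorphM /= conjCi fmorphV /= (CrealP (normr_real h)).
ring.
Qed.

(** The discriminant of a real quadratic whose extreme coefficients have
    opposite signs is nonnegative. *)
Lemma exists_real_root (a b k : C) :
  a \is Num.real -> b \is Num.real -> k \is Num.real -> a * b < 0 ->
  exists2 t : C, t \is Num.real & a + t * k *+ 2 + t ^+ 2 * b = 0.
Proof.
move=> ra rb rk ab0.
have b0 : b != 0 by apply: contraTneq ab0 => ->; rewrite mulr0 ltxx.
have d0 : 0 <= k ^+ 2 - a * b.
  by rewrite subr_ge0 (le_trans (ltW ab0))// real_exprn_even_ge0.
exists ((sqrtC (k ^+ 2 - a * b) - k) / b).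
  by rewrite rpredM ?rpredV// rpredB// ger0_real// sqrtC_ge0.
have -> : forall r : C, r = sqrtC (k ^+ 2 - a * b) ->
   a + (r - k) / b * k *+ 2 + ((r - k) / b) ^+ 2 * b =
   (r ^+ 2 - (k ^+ 2 - a * b)) / b.
  by move=> r _; field.
  by rewrite sqrtCK subrr mul0r.
by [].
Qed.

(** After a change of phase on [y], every real rotation of the plane spanned by
    [x] and [y] keeps both vectors [A]-isotropic, and the tangent of the angle
    making the first one [B]-isotropic solves a real quadratic, solvable
    because [B] has opposite signs at [x] and [y].  The first conclusion says
    that x^* x + y^* y is unchanged. *)
Lemma rotate_pair A B x y : A^t* = A -> B^t* = B ->
  qform A x = 0 -> qform A y = 0 -> qform B x * qform B y < 0 ->
  exists x' y', [/\ forall M, qform M x' + qform M y' = qform M x + qform M y,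
    qform A x' = 0, qform A y' = 0 & qform B x' = 0].
Proof.
move=> hA hB Ax Ay Bxy.
have [e ne he] := exists_phase '[x *m A, y].
pose z := e *: y.
have qz M : qform M z = qform M y by rewrite qformZ ne expr1n mul1r.
have Axz : '[x *m A, z] + '[z *m A, x] = 0.
  by rewrite -he /z -scalemxAl dotmxZl dotmxZr (dotmx_adj _ y) hA -dotmxC.
pose k := '[x *m B, z].
have hk : '[z *m B, x] = k^* by rewrite dotmx_adj hB dotmxC.
have [t rt ht] : exists2 t : C, t \is Num.real &
    qform B x + t * 'Re k *+ 2 + t ^+ 2 * qform B z = 0.
  by apply: exists_real_root; rewrite ?qz ?qform_herm_real ?Creal_Re.
have t1 : 0 < 1 + t ^+ 2 by rewrite ltr_pwDl// real_exprn_even_ge0.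
pose r := (sqrtC (1 + t ^+ 2))^-1.
have nr : `|r| ^+ 2 * (1 + t ^+ 2) = 1.
  have r0 : 0 <= r by rewrite invr_ge0 sqrtC_ge0 ltW.
  by rewrite ger0_norm// exprVn sqrtCK mulVf// gt_eqF.
have ct : t^* = t by apply/CrealP.
have nt : `|t| ^+ 2 = t ^+ 2 by rewrite real_normK.
exists (r *: (x + t *: z)), (r *: (z + (- t) *: x)); split.
- move=> M; rewrite !qformZ !qform_lin -!(qz M) normrN nt rmorphN /= ct.
  rewrite -[RHS]mul1r -nr; ring.
- rewrite qformZ qform_lin qz Ax Ay ct mulr0 addr0 add0r.
  by rewrite -mulrDr Axz !mulr0.
- rewrite qformZ qform_lin qz Ax Ay rmorphN /= ct mulr0 addr0 add0r.
  by rewrite -mulrDr [X in - t * X]addrC Axz !mulr0.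
- rewrite qformZ qform_lin hk ct nt -/k.
  suff -> : qform B x + t * k + t * k^* + t ^+ 2 * qform B z = 0.
    by rewrite mulr0.
  have Rek : 'Re k *+ 2 = k + k^* by rewrite ReE -mulr_natr divfK ?pnatr_eq0.
  by rewrite -[RHS]ht -mulrnAr Rek mulrDr !addrA.
Qed.

(** If the values of [B] sum to zero but one is nonzero, another one has the
    opposite sign; rotating the two vectors creates a [B]-isotropic one, which
    is set aside.  The list that remains is shorter and its values still sum to
    zero. *)
Lemma rebalance A B s : A^t* = A -> B^t* = B ->
  {in s, forall u, qform A u = 0} -> \sum_(u <- s) qform B u = 0 ->
  exists s', (forall M, \sum_(u <- s') qform M u = \sum_(u <- s) qform M u) /\
    {in s', forall u, qform A u = 0 /\ qform B u = 0}.
Proof.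
move=> hA hB.
(* Induction on the length, since a rotation changes the vectors of the list. *)
have [m] := ubnP (size s); elim: m s => // m IH [|x s] /=.
  by exists [::]; split.
rewrite ltnS => sm As; rewrite big_cons.
have [Bx|Bx] := eqVneq (qform B x) 0.
  rewrite Bx add0r => Bs.
  have [|//|s' [s'M s'P]] := IH s sm.
    by move=> u us; rewrite As// inE us orbT.
  exists (x :: s'); split=> [M|u]; first by rewrite !big_cons s'M.
  by rewrite inE => /predU1P[->|/s'P//]; rewrite As ?mem_head.
move=> Bs.
have [y ys Bxy] : exists2 y, y \in s & qform B x * qform B y < 0.
  apply/hasP; rewrite -[has _ _]negbK -all_predC; apply/negP => /allP pos.
  have : 0 <= qform B x * \sum_(u <- s) qform B u.
    rewrite mulr_sumr big_seq sumr_ge0// => u us.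
    by rewrite real_leNgt ?real0 ?rpredM ?qform_herm_real//; exact: pos.
  have -> : \sum_(u <- s) qform B u = - qform B x.
    by apply/eqP; rewrite -addr_eq0 addrC Bs.
  rewrite mulrN oppr_ge0 -expr2 real_exprn_even_le0 ?qform_herm_real//=.
  by rewrite (negbTE Bx).
have Ax : qform A x = 0 by rewrite As ?mem_head.
have Ay : qform A y = 0 by rewrite As// inE ys orbT.
have [x' [y' [M' Ax' Ay' Bx']]] := rotate_pair hA hB Ax Ay Bxy.
have sums M : \sum_(u <- y' :: rem y s) qform M u + qform M x'
    = qform M x + \sum_(u <- s) qform M u.
  rewrite (perm_big _ (perm_to_rem ys)) !big_cons /= addrA -M'.
  by rewrite addrAC [_ y' + _]addrC.
have [|||s' [s'M s'P]] := IH (y' :: rem y s).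
- by rewrite /= size_rem//; case: (s) ys sm.
- move=> u; rewrite inE => /predU1P[->//|/mem_rem us].
  by rewrite As// inE us orbT.
- by rewrite -[LHS]addr0 -[X in _ + X]Bx' sums.
exists (x' :: s'); split=> [M|u].
  by rewrite !big_cons s'M addrC sums.
by rewrite inE => /predU1P[->//|/s'P].
Qed.

(** The Hermitian part [A] and the skew-Hermitian part [B] of [Z], up to scalar
    factors, are treated in turn: the vectors are first made isotropic for [A],
    then for [B] among [A]-isotropic vectors. *)
Lemma isotropic_rearrangement Z s : \sum_(u <- s) qform Z u = 0 ->
  exists s', (forall M, \sum_(u <- s') qform M u = \sum_(u <- s) qform M u) /\
    {in s', forall u, qform Z u = 0}.
Proof.
move=> sZ.
pose A := Z + Z^t*; pose B := 'i *: (Z - Z^t*).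
have adjD (P Q : 'M[C]_n) : (P + Q)^t* = P^t* + Q^t*.
  by rewrite linearD map_mxD.
have adjZ (a : C) (P : 'M[C]_n) : (a *: P)^t* = a^* *: P^t*.
  by rewrite linearZ map_mxZ.
have hA : A^t* = A by rewrite adjD trmxCK addrC.
have hB : B^t* = B.
  by rewrite adjZ conjCi -scaleN1r adjD adjZ rmorphN rmorph1 trmxCK !scaleN1r
     scaleNr -scalerN opprD opprK addrC.
have sZ' : \sum_(u <- s) qform (Z^t*) u = 0.
  by rewrite (eq_bigr _ (fun u _ => qform_adj Z u)) -rmorph_sum sZ rmorph0.
have sA : \sum_(u <- s) qform A u = 0.
  by rewrite (eq_bigr _ (fun u _ => qformD Z _ u)) big_split /= sZ sZ' addr0.
have sB : \sum_(u <- s) qform B u = 0.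
  rewrite (eq_bigr (fun u => 'i * (qform Z u - qform (Z^t*) u))).
    by rewrite -mulr_sumr sumrB sZ sZ' subrr mulr0.
  by move=> u _; rewrite qformZl qformD -scaleN1r qformZl mulN1r.
have h0 : (0 : 'M[C]_n)^t* = 0 by rewrite trmx0 map_mx0.
(* The zero form imposes no constraint in the first pass. *)
have [|s1 [s1M s1P]] := rebalance h0 hA _ sA.
  by move=> u _; rewrite -(scale0r 0) qformZl mul0r.
have [||s2 [s2M s2P]] := @rebalance A B s1 hA hB.
- by move=> u /s1P[].
- by rewrite s1M.
exists s2; split=> [M|u us]; first by rewrite s2M s1M.
have [Au Bu] := s2P u us.
have ZE : 2 *: Z = A + (- 'i) *: B.
  by rewrite scalerA mulNr -expr2 sqrCi opprK scale1r addrACA subrr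
     addr0 -mulr2n scaler_nat.
have := qformZl Z 2 u; rewrite ZE qformD qformZl Au Bu mulr0 addr0 => /esym/eqP.
by rewrite mulf_eq0 pnatr_eq0 /= => /eqP.
Qed.

End QuadraticForms.

(** * The commutator bound from an orthogonal-pair bound *)

Section CommutatorBound.
Variables (C : numClosedFieldType) (n : nat).
Implicit Types (X Y Z M : 'M[C]_n) (u v x y : 'rV[C]_n).

Definition frobenius_sq M := \tr (M *m M^t*).

Lemma adjmxD (P Q : 'M[C]_n) : (P + Q)^t* = P^t* + Q^t*.
Proof. by rewrite linearD map_mxD. Qed.

Lemma adjmxN (P : 'M[C]_n) : (- P)^t* = - P^t*.
Proof. by rewrite linearN map_mxN. Qed.

Lemma adjmxM (P Q : 'M[C]_n) : (P *m Q)^t* = Q^t* *m P^t*.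
Proof. by rewrite trmx_mul map_mxM. Qed.

Lemma sum_qform_row X M :
  \sum_i qform M (row i X) = \tr (X *m M *m X^t*).
Proof.
apply: eq_bigr => i _; rewrite /qform dotmxE -row_mul !mxE.
by apply: eq_bigr => j _; rewrite !mxE.
Qed.

Lemma dotmx_ge0 u : 0 <= '[u].
Proof. exact: (dnorm_ge0 (@dotmx C n)). Qed.

Lemma dotmx_CauchySchwarz u v : `|'[u, v]| ^+ 2 <= '[u] * '[v].
Proof. exact: (CauchySchwarz (@dotmx C n) u v).1. Qed.

Lemma qform_mul_adj M u : qform (M *m M^t*) u = '[u *m M].
Proof. by rewrite /qform mulmxA dotmx_adj trmxCK. Qed.

Lemma qform_adj_mul M u : qform (M^t* *m M) u = '[u *m M^t*].
Proof. by rewrite -qform_mul_adj trmxCK. Qed.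

Lemma frobenius_sq_ge0 M : 0 <= frobenius_sq M.
Proof.
rewrite /frobenius_sq -[M in X in X *m _]mulmx1 -sum_qform_row sumr_ge0// => i _.
by rewrite /qform mulmx1 dotmx_ge0.
Qed.

(** The difference of the two sides is the squared norm of Z X^* + X^* Z. *)
Lemma frobenius_sq_commutator_le X Z : frobenius_sq (commutator X Z) <=
  \tr (X *m (Z *m Z^t* + Z^t* *m Z) *m X^t*) +
  \tr (X^t* *m (Z *m Z^t* + Z^t* *m Z) *m X).
Proof.
rewrite -subr_ge0; apply: le_trans (frobenius_sq_ge0 (Z *m X^t* + X^t* *m Z)) _.
rewrite le_eqVlt; apply/orP; left; apply/eqP.
rewrite /frobenius_sq /commutator !(adjmxD, adjmxN, adjmxM, trmxCK).
rewrite !(mulmxDl, mulmxDr, mulmxN, mulNmx, raddfD, raddfN, opprD, opprK) /=.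
rewrite !mulmxA.
have t1 : \tr (Z *m X^t* *m Z^t* *m X) = \tr (X *m Z *m X^t* *m Z^t*).
  by rewrite mxtrace_mulC !mulmxA.
have t2 : \tr (Z *m X^t* *m X *m Z^t*) = \tr (X *m Z^t* *m Z *m X^t*).
  by rewrite -(mulmxA (Z *m _)) mxtrace_mulC !mulmxA.
have t3 : \tr (X^t* *m Z *m X *m Z^t*) = \tr (Z *m X *m Z^t* *m X^t*).
  by rewrite -!mulmxA mxtrace_mulC !mulmxA.
have t4 : \tr (X^t* *m Z^t* *m Z *m X) = \tr (Z *m X *m X^t* *m Z^t*).
  by rewrite -(mulmxA (_ *m _)) mxtrace_mulC !mulmxA.
rewrite t1 t2 t3 t4; ring.
Qed.

(** The bound 1 instead of an equality makes room for the zero vector.  The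
    normalised vector is exhibited as a multiple of [u] so that it inherits
    orthogonality relations even when [u] is zero. *)
Lemma normalize u : exists2 a, '[a *: u] <= 1 & u = sqrtC '[u] *: (a *: u).
Proof.
have [->|u0] := eqVneq u 0.
  by exists 0; rewrite !scaler0// dotmxE mul0mx mxE ler01.
have nu : '[u] != 0 by rewrite (dnorm_eq0 (@dotmx C n)).
exists (sqrtC '[u])^-1; last by rewrite scalerA divff ?scale1r// sqrtC_eq0.
rewrite dotmxZl dotmxZr mulrA -normCK normfV exprVn.
by rewrite ger0_norm ?sqrtC_ge0 ?dotmx_ge0// sqrtCK mulVf ?lexx.
Qed.

(** For [u] of norm at most 1, the isotropy of [u] makes [u] orthogonal to
    u Z^* and to u Z.  By Pythagoras |u Z^*| <= |u Y^*|.  Moreover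
    |u Z|^2 = <u Y, u Z> = <u, u Z Y^*>, so Cauchy-Schwarz gives
    |u Z| <= |f Y^*| for the normalisation [f] of u Z, and f is orthogonal
    to [u]: the hypothesis applies to the pair [u], [f]. *)
Lemma qform_sub_scalar_le Y Z (c K : C) : Y = Z + c%:M ->
  (forall x y, '[x, y] = 0 -> '[x] <= 1 -> '[y] <= 1 ->
     '[x *m Y^t*] + '[y *m Y^t*] <= K) ->
  forall u, qform Z u = 0 -> qform (Z *m Z^t* + Z^t* *m Z) u <= K * '[u].
Proof.
move=> YZ hK u Zu.
have [a] := normalize u; set e := a *: u => e1 uE; clearbody e.
have nu : `|sqrtC '[u]| ^+ 2 = '[u].
  by rewrite ger0_norm ?sqrtC_ge0 ?dotmx_ge0// sqrtCK.
have [u0|nu0] := eqVneq '[u] 0.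
  by rewrite {1}uE qformZ nu u0 mul0r mulr0. 
have Ze : qform Z e = 0.
  by apply/eqP; move/eqP: Zu; rewrite {1}uE qformZ nu mulf_eq0 (negbTE nu0).
rewrite {1}uE qformZ nu mulrC ler_wpM2r ?dotmx_ge0//.
rewrite qformD qform_mul_adj qform_adj_mul.
have ZY : '[e *m Z^t*] <= '[e *m Y^t*].
  have -> : e *m Y^t* = e *m Z^t* + c^* *: e.
    by rewrite YZ adjmxD mulmxDr tr_scalar_mx map_scalar_mx mul_mx_scalar.
  have eZ : '[e *m Z^t*, e] = 0 by rewrite -/(qform _ _) qform_adj Ze rmorph0.
  rewrite dotmxDl !dotmxDr !dotmxZr !dotmxZl [X in _ <= _ + (_ * X + _)]dotmxC eZ.
  rewrite rmorph0 !mulr0 addr0 add0r lerDl mulrCA mulrA -normCK.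
  by rewrite mulr_ge0 ?dotmx_ge0// exprn_ge0.
have [b] := normalize (e *m Z); set f := b *: _ => f1 vE.
have ef : '[e, f] = 0.
  by rewrite dotmxC dotmxZl -/(qform Z e) Ze mulr0 rmorph0.
clearbody f.
have nv : `|sqrtC '[e *m Z]| ^+ 2 = '[e *m Z].
  by rewrite ger0_norm ?sqrtC_ge0 ?dotmx_ge0// sqrtCK.
have ZYf : '[e *m Z] <= '[f *m Y^t*].
  have [->|v0] := eqVneq '[e *m Z] 0; first exact: dotmx_ge0.
  have vY : '[e *m Z] = '[e, e *m Z *m Y^t*].
    rewrite -(dotmx_adj Y) [in RHS]YZ mulmxDr mul_mx_scalar dotmxDl dotmxZl.
    by rewrite [X in _ + _ * X]dotmxC -/(qform Z e) Ze rmorph0 mulr0 addr0.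
  have := dotmx_CauchySchwarz e (e *m Z *m Y^t*).
  rewrite -vY ger0_norm ?dotmx_ge0// => CS.
  have vpos : 0 < '[e *m Z] by rewrite lt_def v0 dotmx_ge0.
  rewrite -(ler_pM2l vpos) -expr2; apply: le_trans CS _.
  apply: (@le_trans _ _ (1 * '[e *m Z *m Y^t*])).
    by rewrite ler_wpM2r ?dotmx_ge0.
  by rewrite mul1r [in leLHS]vE -scalemxAl dotmxZl dotmxZr mulrA -normCK nv.
apply: le_trans (lerD ZYf ZY) _; rewrite addrC; exact: hK.
Qed.

(** The rows of [X] and of X^* give a decomposition of X X^* + X^* X; the scalar
    [c] is the mean of [Y] for it, so that Y - c I can be made isotropic. *)
Lemma frobenius_sq_commutator_bound X Y (K : C) :
  (forall x y, '[x, y] = 0 -> '[x] <= 1 -> '[y] <= 1 ->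
     '[x *m Y^t*] + '[y *m Y^t*] <= K) ->
  frobenius_sq (commutator X Y) <= 2 * K * frobenius_sq X.
Proof.
move=> hK.
have trC : \tr (X^t* *m X) = frobenius_sq X by rewrite mxtrace_mulC.
have [X0|X0] := eqVneq (frobenius_sq X) 0.
  have X00 : X = 0.
    apply/row_matrixP => i; rewrite row0; apply/eqP.
    rewrite -(dnorm_eq0 (@dotmx C n)); apply/eqP.
    have := X0; rewrite /frobenius_sq -[X in X *m _]mulmx1 -sum_qform_row => /psumr_eq0P.
    move/(_ _ i isT); rewrite /qform mulmx1; apply => j _.
    by rewrite mulmx1 dotmx_ge0.
  rewrite X00 /commutator mul0mx mulmx0 subrr /frobenius_sq.
  by rewrite mul0mx mxtrace0 mulr0.
pose c := (\tr (X *m Y *m X^t*) + \tr (X^t* *m Y *m X)) / (2 * frobenius_sq X).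
pose Z := Y - c%:M.
have -> : commutator X Y = commutator X Z.
  rewrite /commutator /Z mulmxBr mulmxBl scalar_mxC opprB.
  by rewrite subrKA.
pose s := [seq row i X | i <- index_enum 'I_n] ++
  [seq row i (X^t*) | i <- index_enum 'I_n].
have sumE M : \sum_(u <- s) qform M u =
    \tr (X *m M *m X^t*) + \tr (X^t* *m M *m X).
  by rewrite big_cat !big_map /= !sum_qform_row trmxCK.
have sZ : \sum_(u <- s) qform Z u = 0.
  rewrite sumE /Z !mulmxBr !mulmxBl !raddfB /= !mul_mx_scalar -!scalemxAl !mxtraceZ.
  rewrite trC -/(frobenius_sq X) /c; field.
  by [].
have [s' [s'M s'P]] := isotropic_rearrangement sZ.
apply: le_trans (frobenius_sq_commutator_le X Z) _.
rewrite -sumE -s'M.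
have -> : 2 * K * frobenius_sq X = \sum_(u <- s') K * '[u].
  rewrite -mulr_sumr (eq_bigr (qform 1%:M)) => [|u _]; last by rewrite /qform mulmx1.
  by rewrite s'M sumE !mulmx1 trC -/(frobenius_sq X); ring.
rewrite !big_seq ler_sum// => u us.
by apply: (@qform_sub_scalar_le Y Z c) => //; [rewrite subrK | exact: s'P].
Qed.
End CommutatorBound.

(** * The two largest eigenvalues of the Gram matrix *)

Section KyFan.
Variables (C : numClosedFieldType) (n : nat).
Implicit Types (Y M : 'M[C]_n) (u v x y : 'rV[C]_n).

Lemma dotmx_sum u : '[u] = \sum_i `|u 0 i| ^+ 2.
Proof. by rewrite dotmxE mxE; apply: eq_bigr => i _; rewrite !mxE normCK. Qed.

Lemma gram_adj Y : (Y^t* *m Y)^t* = Y^t* *m Y.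
Proof. by rewrite adjmxM trmxCK. Qed.

Lemma gram_spectral Y (U := spectralmx (Y^t* *m Y)) :
  Y^t* *m Y = U^t* *m diag_mx (spectral_diag (Y^t* *m Y)) *m U.
Proof.
have : Y^t* *m Y \is normalmx by apply/normalmxP; rewrite gram_adj.
move/orthomx_spectralP => {1}->.
by rewrite invmx_unitary ?spectral_unitarymx.
Qed.

Lemma dotmx_gram x Y (U := spectralmx (Y^t* *m Y)) : '[x *m Y^t*] =
  \sum_i spectral_diag (Y^t* *m Y) 0 i * `|(x *m U^t*) 0 i| ^+ 2.
Proof.
rewrite -qform_adj_mul {1}gram_spectral -/U /qform mulmxA dotmx_adj mulmxA.
rewrite dotmxE mxE; apply: eq_bigr => i _.
by rewrite mul_mx_diag mxE [in RHS]normCK mulrA [X in X * _ = _]mulrC !mxE.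
Qed.

Lemma dotmx_mul_unitary x (U : 'M[C]_n) : U \is unitarymx -> '[x *m U^t*] = '[x].
Proof. by move=> hU; rewrite dotmx_adj trmxCK mulmxKtV. Qed.

(** The eigenvalue is the squared norm of the image of its eigenvector. *)
Lemma spectral_gram_ge0 Y i : 0 <= spectral_diag (Y^t* *m Y) 0 i.
Proof.
set U := spectralmx (Y^t* *m Y).
suff -> : spectral_diag (Y^t* *m Y) 0 i = '[row i U *m Y^t*] by exact: dotmx_ge0.
rewrite dotmx_gram -/U -row_mul (unitarymxP (spectral_unitarymx _)).
rewrite (bigD1 i)//= big1 => [|j ji]; last first.
  by rewrite !mxE eq_sym (negbTE ji) normr0 expr0n mulr0.
by rewrite !mxE eqxx normr1 expr1n mulr1 addr0.
Qed.

Lemma frobenius_sq_spectral Y :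
  frobenius_sq Y = \sum_i spectral_diag (Y^t* *m Y) 0 i.
Proof.
rewrite /frobenius_sq mxtrace_mulC {1}gram_spectral -mulmxA mxtrace_mulC.
rewrite mulmxtVK ?spectral_unitarymx//.
by apply: eq_bigr => i _; rewrite !mxE eqxx.
Qed.

(** Bessel's inequality for pairs that are orthogonal but only subunit, as
    [normalize] provides: expand the norm of e - <e, x> x - <e, y> y. *)
Lemma bessel2 x y e : '[x, y] = 0 -> '[x] <= 1 -> '[y] <= 1 -> '[e] = 1 ->
  `|'[x, e]| ^+ 2 + `|'[y, e]| ^+ 2 <= 1.
Proof.
move=> xy x1 y1 e1; have yx : '[y, x] = 0 by rewrite dotmxC xy rmorph0.
set a := '[e, x]; set b := '[e, y].
have xe : '[x, e] = a^* by rewrite dotmxC.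
have ye : '[y, e] = b^* by rewrite dotmxC.
have := dotmx_ge0 (e + (- a) *: x + (- b) *: y).
have -> : '[e + (- a) *: x + (- b) *: y] =
    1 - (`|a| ^+ 2 + `|b| ^+ 2) -
    (`|a| ^+ 2 * (1 - '[x]) + `|b| ^+ 2 * (1 - '[y])).
  rewrite !(dotmxDl, dotmxDr, dotmxZl, dotmxZr) xy yx xe ye e1 -/a -/b.
  rewrite !rmorphN /= !normCK; ring.
rewrite xe ye !norm_conjC subr_ge0 => le1; rewrite -subr_ge0.
by apply: le_trans le1; rewrite addr_ge0// mulr_ge0 ?exprn_ge0// subr_ge0.
Qed.

(** Total weight 2 with at most 1 on the largest value: the best choice puts 1 on
    that value and 1 on the second largest. *)
Lemma two_weights_le (I : finType) (d w : I -> C) (i0 : I) (m : C) :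
  0 <= m -> m <= d i0 -> (forall i, i != i0 -> d i <= m) ->
  (forall i, 0 <= w i) -> w i0 <= 1 -> \sum_i w i <= 2 ->
  \sum_i d i * w i <= d i0 + m.
Proof.
move=> m0 md dm w0 w1 w2.
apply: (@le_trans _ _ (d i0 * w i0 + m * (2 - w i0))).
  rewrite (bigD1 i0)//= lerD2l; apply: (@le_trans _ _ (\sum_(i | i != i0) m * w i)).
    by apply: ler_sum => i /dm h; rewrite ler_wpM2r.
  rewrite -mulr_sumr ler_wpM2l// lerBrDl.
  by move: w2; rewrite (bigD1 i0).
have -> : d i0 * w i0 + m * (2 - w i0) = (d i0 - m) * w i0 + m *+ 2 by ring.
have -> : d i0 + m = (d i0 - m) * 1 + m *+ 2 by ring.
by rewrite lerD2r ler_wpM2l// subr_ge0.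
Qed.

(** In an eigenbasis of Y^* Y the left-hand side is a weighted sum of the
    eigenvalues, where the weight of an eigenvector [e] is
    |<x, e>|^2 + |<y, e>|^2. *)
Lemma ky_fan_pair Y (i0 : 'I_n) (m : C) (d := spectral_diag (Y^t* *m Y)) :
  0 <= m -> m <= d 0 i0 -> (forall i, i != i0 -> d 0 i <= m) ->
  forall x y, '[x, y] = 0 -> '[x] <= 1 -> '[y] <= 1 ->
     '[x *m Y^t*] + '[y *m Y^t*] <= d 0 i0 + m.
Proof.
move=> m0 md dm x y xy x1 y1.
have hU := spectral_unitarymx (Y^t* *m Y).
rewrite !dotmx_gram -big_split /=; under eq_bigr do rewrite -mulrDr.
apply: two_weights_le => //.
- by move=> i; rewrite addr_ge0 ?exprn_ge0.
- have E z : (z *m (spectralmx (Y^t* *m Y))^t*) 0 i0 =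
      '[z, row i0 (spectralmx (Y^t* *m Y))].
    by rewrite dotmxE !mxE; apply: eq_bigr => j _; rewrite !mxE.
  rewrite !E; apply: bessel2 => //.
  by rewrite (row_unitarymxP hU) eqxx.
- by rewrite big_split /= -!dotmx_sum !dotmx_mul_unitary// lerD.
Qed.
End KyFan.

(** * Singular values and Schatten norms *)

Section SingularValues.
Variable R : realType.
Local Open Scope complex_scope.

(** Nonnegativity makes the default value 0 of the sequence a correct second
    value when [n] is 1. *)
Lemma sort_top_two (n : nat) (f : 'I_n -> R)
    (s := sort >=%R [seq f i | i <- enum 'I_n]) :
  (0 < n)%N -> (forall i, 0 <= f i) ->
  [/\ 0 <= s`_1, s`_1 <= s`_0 &
    exists2 i0, f i0 = s`_0 & forall i, i != i0 -> f i <= s`_1].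
Proof.
move=> n0 f0.
have ps : perm_eq s [seq f i | i <- enum 'I_n] by rewrite perm_sort.
have ss : sorted >=%R s by apply: sort_sorted => x y; exact: le_total.
have pos x : x \in s -> 0 <= x by rewrite (perm_mem ps) => /mapP[i _ ->].
have : size s = n by rewrite (perm_size ps) size_map size_enum_ord.
case: s ps ss pos => [|h t] ps ss pos sz; first by rewrite -sz in n0.
have ht : {in t, forall x, x <= h}.
  move=> x xt; move: ss => /=; rewrite path_sortedE; last exact: rev_trans le_trans.
  by case/andP => /allP/(_ _ xt).
have [i0 _ hE] : exists2 i0, i0 \in enum 'I_n & h = f i0.
  by apply/mapP; rewrite -(perm_mem ps) mem_head.
have pt : perm_eq t [seq f i | i <- rem i0 (enum 'I_n)].
  rewrite -(perm_cons h) (perm_trans ps)// hE -map_cons perm_map//.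
  by rewrite perm_to_rem// mem_enum.
have ft i : i != i0 -> f i \in t.
  by move=> ii0; rewrite (perm_mem pt) map_f// mem_rem_uniq ?enum_uniq//
     inE ii0 mem_enum.
have t0 x : x \in t -> x <= t`_0.
  case: (t) ss => // h' t' /= /andP[_].
  rewrite path_sortedE; last exact: rev_trans le_trans.
  case/andP => /allP ht' _; rewrite inE => /predU1P[->//|/ht'//].
split => /=.
- by case: (t) pos => //= h' t'; apply; rewrite !inE eqxx orbT.
- case: (t) ht pos => /= [_ pos|h' t' -> //]; last by rewrite mem_head.
  by apply: pos; rewrite mem_head.
- by exists i0 => // i /ft/t0.
Qed.

Lemma ge0_Re (z : R[i]) : 0 <= z -> (complex.Re z)%:C = z.
Proof. by move=> z0; rewrite RRe_real ?ger0_real. Qed.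

Lemma Re_ge0 (z : R[i]) : 0 <= z -> 0 <= complex.Re z.
Proof. by case: z => a b; rewrite lecE /= => /andP[]. Qed.

Lemma schatten_norm2E n (Y : 'M[R[i]]_n) :
  ((schatten_norm 2 Y) ^+ 2)%:C = frobenius_sq Y.
Proof.
rewrite /schatten_norm /singular_values.
rewrite (perm_big _ (permEl (perm_sort _ _))) big_map big_enum /=.
rewrite (eq_bigr (fun i => complex.Re (spectral_diag (Y^t* *m Y) 0 i))).
  rewrite powR12_sqrt ?sqr_sqrtr.
  - rewrite rmorph_sum /= frobenius_sq_spectral; apply: eq_bigr => i _.
    by rewrite ge0_Re ?spectral_gram_ge0.
  - by rewrite sumr_ge0// => i _; rewrite Re_ge0 ?spectral_gram_ge0.
  - by rewrite sumr_ge0// => i _; rewrite Re_ge0 ?spectral_gram_ge0.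
move=> i _; rewrite powR_mulrn ?sqrtr_ge0// sqr_sqrtr//.
by rewrite Re_ge0 ?spectral_gram_ge0.
Qed.

Lemma ky_fan22_pair n (Y : 'M[R[i]]_n) (x y : 'rV[R[i]]_n) :
  '[x, y] = 0 -> '[x] <= 1 -> '[y] <= 1 ->
  '[x *m Y^t*] + '[y *m Y^t*] <= (ky_fan22_norm Y ^+ 2)%:C.
Proof.
case: (posnP n) => [n0|n0] xy x1 y1.
  move: (Y) (x) (y); rewrite n0 => Y' x' y'.
  rewrite !dotmxE !mxE !big_ord0 addr0 lecR sqr_ge0 //.
set f := fun i => Num.sqrt (complex.Re (spectral_diag (Y^t* *m Y) 0 i)).
have [] := @sort_top_two n f n0; first by move=> i; rewrite sqrtr_ge0.
rewrite -/(singular_values Y) => s1 s10 [i0 i0E i0P].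
have dE i : spectral_diag (Y^t* *m Y) 0 i = ((f i) ^+ 2)%:C.
  by rewrite sqr_sqrtr ?ge0_Re ?Re_ge0// spectral_gram_ge0.
rewrite /ky_fan22_norm sqr_sqrtr ?addr_ge0 ?sqr_ge0// rmorphD /= -i0E -dE.
apply: ky_fan_pair => //.
- by rewrite lecR sqr_ge0.
- by rewrite dE lecR i0E ler_sqr ?nnegrE// (le_trans s1).
- by move=> i /i0P fi; rewrite dE lecR ler_sqr ?nnegrE// sqrtr_ge0.
Qed.

Lemma schatten_norm_ge0 p n (Y : 'M[R[i]]_n) : 0 <= schatten_norm p Y.
Proof. exact: powR_ge0. Qed.

Lemma schatten2_commutator_le n (X Y : 'M[R[i]]_n) :
  schatten_norm 2 (commutator X Y)
    <= Num.sqrt 2 * schatten_norm 2 X * ky_fan22_norm Y.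
Proof.
rewrite -ler_sqr ?nnegrE ?mulr_ge0 ?schatten_norm_ge0 ?sqrtr_ge0//.
have := frobenius_sq_commutator_bound X (@ky_fan22_pair n Y).
rewrite -!schatten_norm2E -(rmorph_nat (real_complex R)) -!rmorphM /= lecR.
by rewrite !exprMn (@sqr_sqrtr _ 2) ?ler0n// mulrAC.
Qed.

Lemma singular_values_ge0 n (Y : 'M[R[i]]_n) :
  {in singular_values Y, forall s, 0 <= s}.
Proof.
by move=> s; rewrite mem_sort => /mapP[i _ ->]; rewrite sqrtr_ge0.
Qed.

Lemma powR_first_two_le (p : R) (s : seq R) : p != 0 ->
  s`_0 `^ p + s`_1 `^ p <= \sum_(x <- s) x `^ p.
Proof.
move=> p0; case: s => [|a [|b s]] /=.
- by rewrite big_nil powR0// addr0.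
- by rewrite big_seq1 powR0// addr0.
- by rewrite !big_cons addrA lerDl sumr_ge0// => x _; rewrite powR_ge0.
Qed.

(** With N = a^p + b^p: for p <= 2, a^2 = a^p (a^p)^((2-p)/p) <= a^p N^((2-p)/p),
    and likewise for b, so that a^2 + b^2 <= N^(2/p).  For p > 2, Hoelder's
    inequality with exponents p/2 and p/(p-2) is applied to (a^2, b^2) and
    (1, 1). *)
Lemma sqrt2_norm2_le (a b p : R) : 0 <= a -> 0 <= b -> 1 <= p ->
  Num.sqrt 2 * Num.sqrt (a ^+ 2 + b ^+ 2)
    <= 2 `^ (Num.max (1 / 2) (1 - 1 / p)) * (a `^ p + b `^ p) `^ p^-1.
Proof.
move=> a0 b0 p1; have p0 : 0 < p by apply: lt_le_trans p1.
have N0 : 0 <= a `^ p + b `^ p by rewrite addr_ge0 ?powR_ge0.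
have s0 : 0 <= a ^+ 2 + b ^+ 2 by rewrite addr_ge0 ?sqr_ge0.
have [p2|p2] := leP p 2.
  apply: ler_pM; rewrite ?sqrtr_ge0//.
    rewrite -powR12_sqrt// ler_powR ?ler1n// le_max div1r lexx//.
  have [N0'|Npos] := eqVneq (a `^ p + b `^ p) 0.
    move/eqP: N0'; rewrite paddr_eq0 ?powR_ge0// => /andP[/eqP aE /eqP bE].
    rewrite (powR_eq0_eq0 aE) (powR_eq0_eq0 bE) expr0n addr0 sqrtr0.
    exact: powR_ge0.
  rewrite -powR12_sqrt//.
  have -> : p^-1 = (2 / p) * 2^-1 by field; rewrite gt_eqF.
  rewrite powRrM ge0_ler_powR ?nnegrE ?powR_ge0 ?invr_ge0//.
  set N := a `^ p + b `^ p in N0 Npos *.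
  have term c : 0 <= c -> c `^ p <= N -> c ^+ 2 <= c `^ p * N `^ ((2 - p) / p).
    move=> c0 cN.
    have cE : c ^+ 2 = c `^ p * (c `^ p) `^ ((2 - p) / p).
      have [->|cn0] := eqVneq c 0; first by rewrite powR0 ?gt_eqF// mul0r expr0n.
      rewrite -powRrM [p * _]mulrC divfK ?gt_eqF// -powRD ?cn0 ?implybT//.
      by rewrite subrKC powR_mulrn.
    rewrite cE ler_wpM2l ?powR_ge0// ge0_ler_powR ?nnegrE ?powR_ge0//.
    by rewrite divr_ge0 ?subr_ge0// ltW.
  apply: (@le_trans _ _ (a `^ p * N `^ ((2 - p) / p) +
      b `^ p * N `^ ((2 - p) / p))).
    by rewrite lerD// term// ?lerDl ?lerDr ?powR_ge0.
  rewrite -mulrDl -/N -{1}[N]powRr1// -powRD; last by rewrite Npos implybT.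
  rewrite le_eqVlt; apply/orP; left; apply/eqP.
  by congr (_ `^ _); field; rewrite gt_eqF.
rewrite (_ : Num.max _ _ = 1 - 1 / p); last first.
  by apply/max_idPr; rewrite lerBrDr -lerBrDl ler_pdivrMr//; lra.
rewrite -sqrtrM ?ler0n// -powR12_sqrt ?mulr_ge0//.
have -> : 1 - 1 / p = 2^-1 + (1 - 2 / p) * 2^-1 by field; rewrite gt_eqF.
have -> : (a `^ p + b `^ p) `^ p^-1 = ((a `^ p + b `^ p) `^ (2 / p)) `^ 2^-1.
  by rewrite -powRrM; congr (_ `^ _); field; rewrite gt_eqF.
rewrite powRD ?pnatr_eq0 ?implybT// !powRrM -!powRM ?mulr_ge0 ?powR_ge0//.
rewrite ge0_ler_powR ?nnegrE ?mulr_ge0 ?powR_ge0 ?invr_ge0//.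
rewrite -mulrA ler_wpM2l// [leRHS]mulrC.
have : a ^+ 2 * 1 + b ^+ 2 * 1 <=
    ((a ^+ 2) `^ (p / 2) + (b ^+ 2) `^ (p / 2)) `^ (p / 2)^-1 *
    (1 `^ (p / (p - 2)) + 1 `^ (p / (p - 2))) `^ (p / (p - 2))^-1.
  have q0 : 0 < p - 2 by rewrite subr_gt0.
  apply: hoelder2; rewrite ?sqr_ge0 ?divr_gt0//.
  by field; rewrite !gt_eqF.
rewrite !mulr1 !powR1 -!powR_mulrn// -!powRrM.
have -> : 2 * (p / 2) = p by field.
have -> : (p / 2)^-1 = 2 / p by field; rewrite gt_eqF.
have -> : (p / (p - 2))^-1 = 1 - 2 / p by field; rewrite !gt_eqF ?subr_gt0.
by [].
Qed.

End SingularValues.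

Theorem corollary5 (R : realType) (n : nat) (X Y : 'M[R[i]]_n) (p : R)
    (hp : 1 <= p) :
  schatten_norm 2 (commutator X Y)
    <= Num.sqrt 2 * schatten_norm 2 X * ky_fan22_norm Y /\
  Num.sqrt 2 * schatten_norm 2 X * ky_fan22_norm Y
    <= 2 `^ (Num.max (1 / 2) (1 - 1 / p)) * schatten_norm 2 X * schatten_norm p Y.
Proof.
split; first exact: schatten2_commutator_le.
rewrite mulrAC [leRHS]mulrAC ler_wpM2r ?schatten_norm_ge0//.
have p0 : 0 < p by apply: lt_le_trans hp.
have nth_ge0 k : 0 <= (singular_values Y)`_k.
  have [kY|kY] := ltnP k (size (singular_values Y)); last by rewrite nth_default.
  exact/singular_values_ge0/mem_nth.
apply: le_trans (sqrt2_norm2_le (nth_ge0 0) (nth_ge0 1) hp) _.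
rewrite ler_wpM2l ?powR_ge0// ge0_ler_powR ?nnegrE ?addr_ge0 ?powR_ge0
  ?invr_ge0 ?(ltW p0)//.
  by rewrite sumr_ge0// => s _; rewrite powR_ge0.
by rewrite powR_first_two_le// gt_eqF.
Qed.
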